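(* Let $f=\frac1n\sum_{i=1}^n f_i:\mathbb{R}^d\to\mathbb{R}$ be $L_f$-smooth and let each $f_i:\mathbb{R}^d\to\mathbb{R}$ be $L$-smooth (no convexity assumed). Let $\mathcal{P}$ be a proper uniform distribution over subsets of $\{1,\dots,n\}$ with expected minibatch size $\tau$, and let $\mathcal{A},\mathcal{B}\ge 0$ be constants such that $\mathbb{E}_{S\sim\mathcal{P}}\big[\|\sum_{i\in S}\frac{a_i}{p_i}\|^2\big]\le \mathcal{A}\sum_{i=1}^n\|a_i\|^2+\mathcal{B}\|\sum_{i=1}^n a_i\|^2$ for all $a_1,\dots,a_n\in\mathbb{R}^d$. Let $M=\max_{1\le i\le n}\mathbb{E}[|S|\mid i\in S]$ and assume $\frac{n^2}{\tau\mathcal{A}}\ge 24\left(\frac{6M}{\tau}+1\right)$. Let $q=\max\{4,\,2\mathcal{B}(\frac{6M}{\tau}+1)\}$, $\beta=\frac{1}{2\gamma}$, $\alpha=\frac{\beta}{q}$, and $$\Psi^k=f(x^k)+\alpha\cdot\frac1n\sum_{i=1}^n\|x^k-\phi_i^k\|^2.$$ If the stepsize $\gamma>0$ of Minibatch MISO satisfies $$\gamma\le\min\left\{\frac{n}{2\mathcal{B}L_f\tau},\ \frac{n^2/(\tau\mathcal{A})}{24qL_f},\ \frac{(n^2/(\tau\mathcal{A}))^{1/3}}{(24qL_fL^2)^{1/3}},\ \frac{(n^2/(\tau\mathcal{A}))^{1/2}}{(24(6M/\tau+1)L^2)^{1/2}}\right\},$$ then for all $k\ge 0$ $$\mathbb{E}_k[\Psi^{k+1}]\le\Psi^k-\frac{\gamma\tau}{4n}\|\nabla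 f(x^k)\|^2.$$
   Context: A differentiable function is $L$-smooth if its gradient is Lipschitz with constant $L\ge 0$; $f'=\nabla f$ and $f_i'$ denote gradients. $\|\cdot\|$ is the Euclidean norm. Fractions with zero denominator in the stepsize bound and in the condition on $n^2/(\tau\mathcal{A})$ are read as $+\infty$. Sampling: for a distribution $\mathcal{P}$ over the $2^n$ subsets of $\{1,\dots,n\}$ and $S\sim\mathcal{P}$, put $p_i=\mathbb{P}(i\in S)$. $\mathcal{P}$ is proper if $p_i>0$ for all $i$, and uniform if $p_i=p_j$ for all $i,j$. The expected minibatch size is $\tau=\mathbb{E}[|S|]$. Minibatch MISO with stepsize $\gamma>0$: given arbitrary deterministic $\phi_1^0,\dots,\phi_n^0\in\mathbb{R}^d$, set $x^0=\frac1n\sum_{i=1}^n\phi_i^0-\frac{\gamma}{n}\sum_{i=1}^n f_i'(\phi_i^0)$. For $k=0,1,\dots$: draw $S^k\sim\mathcal{P}$ independently of the past; set $\phi_i^{k+1}=x^k$ if $i\in S^k$ and $\phi_i^{k+1}=\phi_i^k$ if $i\notin S^k$; set $x^{k+1}=\frac1n\sum_{i=1}^n\phi_i^{k+1}-\frac{\gamma}{n}\sum_{i=1}^n f_i'(\phi_i^{k+1})$. $\mathbb{E}_k[\cdot]$ denotes conditional expectation given $x^k$ and $\phi_1^k,\dots,\phi_n^k$. Standing assumption: $f$ is bounded below and has a nonempty set of minimizers. *)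

(* Defs.v *)
From mathcomp Require Import all_boot all_order all_algebra.
From mathcomp Require Import all_classical all_reals all_analysis.

Set Implicit Arguments.
Unset Strict Implicit.
Unset Printing Implicit Defensive.

Import Order.TTheory GRing.Theory Num.Theory.
Import numFieldNormedType.Exports.

Local Open Scope classical_set_scope.
Local Open Scope ring_scope.

(* The library norm on 'rV[R]_d is the sup norm (it induces the same topology,
   hence the same notion of differentiability). *)
Definition enorm (R : realType) (d : nat) (x : 'rV[R]_d) : R :=
  Num.sqrt (\sum_(j < d) x 0 j ^+ 2).

(* Meaningful only where g is differentiable, which smoothness requires. *)
Definition grad (R : realType) (d : nat) (g : 'rV[R]_d -> R) (x : 'rV[R]_d) :
    'rV[R]_d :=
  \row_(j < d) 'D_('e_j) g x.

Definition smooth (R : realType) (d : nat) (L : R) (g : 'rV[R]_d -> R) : Prop :=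
  [/\ 0 <= L,
      forall x, differentiable g x &
      forall x y, enorm (grad g x - grad g y) <= L * enorm (x - y)].

Definition avg (R : realType) (n d : nat) (f : 'I_n -> 'rV[R]_d -> R)
    (x : 'rV[R]_d) : R :=
  n%:R^-1 * \sum_(i < n) f i x.

Section Sampling.
Context (R : realType) (n : nat) (mu : {set 'I_n} -> R).

Definition sampling_distribution : Prop :=
  (forall A, 0 <= mu A) /\ \sum_(A : {set 'I_n}) mu A = 1.

Definition inclusion_prob (i : 'I_n) : R :=
  \sum_(A : {set 'I_n} | i \in A) mu A.

Definition proper_sampling : Prop := forall i, 0 < inclusion_prob i.

Definition uniform_sampling : Prop :=
  forall i j, inclusion_prob i = inclusion_prob j.

Definition expected_size : R := \sum_(A : {set 'I_n}) mu A * #|A|%:R.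

(* E[ |S| | i \in S ] *)
Definition cond_expected_size (i : 'I_n) : R :=
  (\sum_(A : {set 'I_n} | i \in A) mu A * #|A|%:R) / inclusion_prob i.

(* The default value 0 of the maximum is harmless: all entries are
   nonnegative. *)
Definition max_cond_expected_size : R :=
  \big[Num.max/0]_(i < n) cond_expected_size i.

Definition sampling_variance_bound (d : nat) (A B : R) : Prop :=
  forall a : 'I_n -> 'rV[R]_d,
    \sum_(S : {set 'I_n})
       mu S * enorm (\sum_(i in S) (inclusion_prob i)^-1 *: a i) ^+ 2 <=
    A * (\sum_(i < n) enorm (a i) ^+ 2) + B * enorm (\sum_(i < n) a i) ^+ 2.

End Sampling.

Section MISO.
Context (R : realType) (n d : nat) (f : 'I_n -> 'rV[R]_d -> R) (gamma : R).

Definition miso_point (phi : 'I_n -> 'rV[R]_d) : 'rV[R]_d :=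
  n%:R^-1 *: (\sum_(i < n) phi i) -
  (gamma / n%:R) *: (\sum_(i < n) grad (f i) (phi i)).

Context (phi0 : 'I_n -> 'rV[R]_d).

(* One trajectory, as a function of the sequence s of sampled minibatches. *)
Fixpoint miso_phi (s : nat -> {set 'I_n}) (k : nat) : 'I_n -> 'rV[R]_d :=
  match k with
  | 0 => phi0
  | k'.+1 => fun i => if i \in s k' then miso_point (miso_phi s k')
                      else miso_phi s k' i
  end.

Definition miso_x (s : nat -> {set 'I_n}) (k : nat) : 'rV[R]_d :=
  miso_point (miso_phi s k).

Definition miso_psi (alpha : R) (s : nat -> {set 'I_n}) (k : nat) : R :=
  avg f (miso_x s k) +
  alpha * (n%:R^-1 * \sum_(i < n) enorm (miso_x s k - miso_phi s k i) ^+ 2).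

End MISO.

Section Conditioning.
Context (R : realType) (disp : measure_display) (T : measurableType disp)
        (P : probability T R).

(* S k has law mu and is independent of S 0, ..., S k.-1. *)
Definition independent_draws (n : nat) (mu : {set 'I_n} -> R)
    (S : nat -> T -> {set 'I_n}) : Prop :=
  forall k A,
    [/\ measurable (S k @^-1` [set A]),
        P (S k @^-1` [set A]) = (mu A)%:E &
        forall s : nat -> {set 'I_n},
          let past := [set w | forall j, (j < k)%N -> S j w = s j] in
          P (S k @^-1` [set A] `&` past) = (P (S k @^-1` [set A]) * P past)%E].

(* The sigma-algebra generated by x and phi_1, ..., phi_n; 'rV[R]_d carries its
   Borel sigma-algebra. *)
Definition sigma_state (n d : nat) (x : T -> 'rV[R]_d)
    (phi : 'I_n -> T -> 'rV[R]_d) : set (set T) :=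
  <<s [set x @^-1` U | U in @open 'rV[R]_d] `|`
      \bigcup_(i in [set: 'I_n]) [set phi i @^-1` U | U in @open 'rV[R]_d] >>.

(* Z is a version of E[X | G], for a sub-sigma-algebra G. *)
Definition is_cond_expectation (G : set (set T)) (X Z : T -> R) : Prop :=
  [/\ P.-integrable setT (EFin \o X),
      P.-integrable setT (EFin \o Z),
      forall B : set R, measurable B -> G (Z @^-1` B) &
      forall A, G A ->
        (\int[P]_(w in A) (Z w)%:E = \int[P]_(w in A) (X w)%:E)%E].

End Conditioning.

(* Main.v *)
Require Import Defs.
From mathcomp Require Import all_boot all_order all_algebra.
From mathcomp Require Import all_classical all_reals all_analysis.
From mathcomp Require Import ring lra.

Set Implicit Arguments.
Unset Strict Implicit.
Unset Printing Implicit Defensive.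

Import Order.TTheory GRing.Theory Num.Theory.
Import numFieldNormedType.Exports.

Local Open Scope classical_set_scope.
Local Open Scope ring_scope.

(** Fix a state phi and put x = miso_point phi, v_i = x - phi_i,
    g_i = v_i - gamma (f_i'(x) - f_i'(phi_i)), p = tau / n and
    r = tau A / n^2. If S is the next minibatch, the iterate moves by
    D = n^-1 sum_(i in S) g_i. Since x is itself the point attached to phi, the
    terms in phi cancel in the full sum of the g_i, which leaves
    - gamma n grad f(x): although the step is built from outdated gradients, its
    mean E D = - gamma p grad f(x) is an exact gradient step
    (mean_miso_shift).

    With Phi = n^-1 sum |v_i|^2 and G = |grad f(x)|^2, two estimates control the
    rest. The variance hypothesis applied to the g_i bounds E|D|^2 by
    2 (1 + gamma^2 L^2) p r Phi + B gamma^2 p^2 G (mean_sqr_shift_le). The mean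
    squared distance to the stored points contracts (mean_gap_after_le): the
    expectation of its new value is at most
    (1 + 6 M / n) E|D|^2 + (1 - p / 3) Phi + 2 gamma^2 p G, because a stored
    point is refreshed with probability p, and Young's inequality spends
    p/2 + p/6 of this gain on the cross terms. A single application of Young's
    inequality would cost a factor of order 1/p in front of E|D|^2; expanding
    the square and treating the indices inside S separately replaces it by
    M / n, where M enters through E[|S| sum_(i in S) |v_i|^2] <= M p sum |v_i|^2.

    Adding alpha times the second estimate to the descent inequality for f
    (smooth_descent), everything is linear in G and Phi, and the stepsize
    conditions are what makes the coefficients close up (lyapunov_balance): the
    G terms consume at most 3/4 of gamma p G, and the Phi terms are four
    quantities of size at most alpha p / 12, one for each of the conditions that
    involve the number 24, hence at most alpha p / 3 together.

    It remains to identify the conditional expectation. The state at time k is a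
    function of the finitely many values of the past draws, so the
    sigma-algebra that it generates consists exactly of the preimages under the
    state (sigma_state_finite). Averaging over an independent draw is then a
    version of the conditional expectation (averaged_draw_cond_expectation), and
    any other version agrees with it almost surely, because both are constant
    on each of the finitely many fibres of the state
    (cond_expectation_unique). *)

(** * Euclidean inner product *)

Section Euclidean.
Context {R : realType} {d : nat}.
Implicit Types (u v w : 'rV[R]_d) (c : R).

Definition dot u v : R := \sum_(j < d) u 0 j * v 0 j.

Lemma dotC u v : dot u v = dot v u.
Proof. by apply: eq_bigr => j _; rewrite mulrC. Qed.

Lemma dotDl u v w : dot (u + v) w = dot u w + dot v w.
Proof. by rewrite -big_split; apply: eq_bigr => j _; rewrite mxE mulrDl. Qed.

Lemma dotZl c u v : dot (c *: u) v = c * dot u v.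
Proof. by rewrite mulr_sumr; apply: eq_bigr => j _; rewrite mxE mulrA. Qed.

Lemma dotNl u v : dot (- u) v = - dot u v.
Proof. by rewrite -scaleN1r dotZl mulN1r. Qed.

Lemma dotBl u v w : dot (u - v) w = dot u w - dot v w.
Proof. by rewrite dotDl dotNl. Qed.

Lemma dotDr w u v : dot w (u + v) = dot w u + dot w v.
Proof. by rewrite dotC dotDl !(dotC w). Qed.

Lemma dotZr c u v : dot v (c *: u) = c * dot v u.
Proof. by rewrite dotC dotZl (dotC v). Qed.

Lemma dotNr v u : dot v (- u) = - dot v u.
Proof. by rewrite dotC dotNl (dotC v). Qed.

Lemma dotBr w u v : dot w (u - v) = dot w u - dot w v.
Proof. by rewrite dotDr dotNr. Qed.

Lemma dot0r w : dot w 0 = 0.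
Proof. by rewrite -(scale0r 0) dotZr mul0r. Qed.

Lemma dot_sumr (I : Type) (r : seq I) (Q : pred I) (F : I -> 'rV[R]_d) w :
  dot w (\sum_(i <- r | Q i) F i) = \sum_(i <- r | Q i) dot w (F i).
Proof. by apply: (big_morph _ (dotDr w) (dot0r w)). Qed.

Lemma enorm_ge0 u : 0 <= enorm u.
Proof. exact: sqrtr_ge0. Qed.

Lemma enorm_sqr u : enorm u ^+ 2 = dot u u.
Proof.
have -> : dot u u = \sum_(j < d) u 0 j ^+ 2 by apply: eq_bigr.
by rewrite sqr_sqrtr// sumr_ge0// => j _; rewrite sqr_ge0.
Qed.

Lemma dotuu_ge0 u : 0 <= dot u u.
Proof. by rewrite -enorm_sqr sqr_ge0. Qed.

Lemma enormZ c u : enorm (c *: u) = `|c| * enorm u.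
Proof.
by rewrite -(ger0_norm (enorm_ge0 (c *: u))) -(ger0_norm (enorm_ge0 u))
  -!sqrtr_sqr !enorm_sqr dotZl dotZr mulrA -expr2 sqrtrM ?sqr_ge0.
Qed.

(** The squared norm of <v,v> u - <u,v> v is <v,v> times the defect in the
    squared inequality. *)
Lemma cauchy_schwarz_enorm u v : dot u v <= enorm u * enorm v.
Proof.
apply: le_trans (ler_norm _) _.
rewrite -(@ler_pXn2r _ 2) ?nnegrE ?mulr_ge0 ?enorm_ge0// exprMn !enorm_sqr.
rewrite real_normK ?num_real//.
have [vv0|vv_neq0] := eqVneq (dot v v) 0.
  suff -> : v = 0 by rewrite dot0r expr0n mulr_ge0 ?dotuu_ge0.
  apply/rowP => j; apply/eqP; rewrite mxE -sqrf_eq0 expr2.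
  have vv_ge0 (i : 'I_d) : true -> 0 <= v 0 i * v 0 i by rewrite -expr2 sqr_ge0.
  by rewrite (psumr_eq0P vv_ge0 vv0).
have vv_gt0 : 0 < dot v v by rewrite lt_def vv_neq0 dotuu_ge0.
have := dotuu_ge0 (dot v v *: u - dot u v *: v).
rewrite !(dotBl, dotBr, dotZl, dotZr) (dotC v u).
nra.
Qed.

Lemma sqr_dotD u v : dot (u + v) (u + v) = dot u u + 2 * dot v u + dot v v.
Proof. by rewrite dotDl !dotDr (dotC u v); ring. Qed.

Lemma sqr_dotB_le u v : dot (u - v) (u - v) <= 2 * (dot u u + dot v v).
Proof.
have := dotuu_ge0 (u + v).
by rewrite !sqr_dotD !(dotNl, dotNr) opprK; lra.
Qed.

(** Expand |c u - v|^2 >= 0 and divide by c. *)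
Lemma young c u v : 0 < c ->
  2 * dot u v <= c * dot u u + c^-1 * dot v v.
Proof.
move=> c_gt0; have := dotuu_ge0 (c *: u - v).
rewrite !(dotBl, dotBr, dotZl, dotZr) (dotC v u) => h.
rewrite -(ler_pM2l c_gt0) mulrDr (mulrA c c^-1) divff ?gt_eqF// mul1r.
lra.
Qed.

End Euclidean.

(** * Gradients and the descent inequality *)

Section Gradient.
Context {R : realType} {d : nat}.
Implicit Types (g : 'rV[R]_d -> R) (x y v : 'rV[R]_d).

Lemma derive_grad g x v : differentiable g x -> 'D_v g x = dot (grad g x) v.
Proof.
move=> dg; rewrite deriveE// [in LHS](row_sum_delta v) linear_sum.
by apply: eq_bigr => j _; rewrite linearZ mxE deriveE// mulrC.
Qed.

(** The difference quotient of the restriction to a line is, term by term, the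
    one that defines the directional derivative. *)
Lemma is_derive_line g x v (t : R) : differentiable g (x + t *: v) ->
  is_derive t 1 (fun s : R => g (x + s *: v)) (dot (grad g (x + t *: v)) v).
Proof.
move=> dg; rewrite -derive_grad//.
have quotE : (fun h : R => h^-1 *: (((fun s : R => g (x + s *: v)) \o shift t)
      (h *: 1) - g (x + t *: v))) =
    (fun h : R => h^-1 *: ((g \o shift (x + t *: v)) (h *: v) - g (x + t *: v))).
  apply/funext => h /=; congr (_ *: (g _ - _)).
  by rewrite -[h *: 1]/(h * 1) mulr1 scalerDl addrCA.
split; last by rewrite /derive quotE.
by rewrite /derivable quotE; apply: diff_derivable.
Qed.

(** On the segment from x to y the difference between g and the quadratic upper
    model has a nonpositive derivative, by Cauchy-Schwarz and the Lipschitz bound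
    on the gradient, so it decreases from its value at x. *)
Lemma smooth_descent (L : R) g x y : smooth L g ->
  g y <= g x + dot (grad g x) (y - x) + L / 2 * dot (y - x) (y - x).
Proof.
case=> L_ge0 dg gradL; set v := y - x.
pose gap (t : R) := g (x + t *: v) -
  (t * dot (grad g x) v + L / 2 * dot v v * t ^+ 2).
pose dgap (t : R) := dot (grad g (x + t *: v)) v -
  (dot (grad g x) v + L * dot v v * t).
have gapD (t : R) : is_derive t 1 gap (dgap t).
  have line := is_derive_line (dg (x + t *: v)).
  (* As a polynomial, the quadratic model is differentiated formally. *)
  pose parabola : {poly R} := dot (grad g x) v *: 'X + (L / 2 * dot v v) *: 'X^2.
  have -> : gap = (fun s : R => g (x + s *: v)) - horner parabola.
    apply/funext => s; rewrite /gap /parabola !fctE !hornerE/=.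
    by congr (_ - (_ + _)); rewrite mulrC.
  have -> : dgap t = dot (grad g (x + t *: v)) v - parabola^`().[t].
    by rewrite /dgap /parabola !poly.derivE !hornerE/=; congr (_ - _); lra.
  exact: is_deriveB line (is_derive_poly parabola t).
have dgap_le0 (t : R) : 0 <= t -> dgap t <= 0.
  move=> t_ge0; rewrite /dgap opprD addrA -dotBl subr_le0.
  apply: le_trans (cauchy_schwarz_enorm _ _) _.
  have := gradL (x + t *: v) x.
  rewrite addrAC subrr add0r enormZ ger0_norm// => gradLt.
  apply: le_trans (ler_wpM2r (enorm_ge0 v) gradLt) _.
  by rewrite -enorm_sqr; lra.
have gap_le : gap 1 <= gap 0.
  apply: (@ler0_derive1_le_cc _ gap 0 1); rewrite ?in_itv/= ?lexx ?ler01 //.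
  - move=> t; rewrite in_itv/= => /andP[/ltW t_ge0 _].
    by rewrite derive1E (@derive_val _ _ _ _ _ _ _ (gapD t)) dgap_le0.
  - apply: continuous_subspaceT => t.
    by apply/differentiable_continuous/derivable1_diffP; case: (gapD t).
move: gap_le; rewrite /gap scale1r scale0r addr0 expr1n expr0n /v.
by rewrite addrCA subrr addr0 -/v /= mul1r mul0r mulr0 mulr1 addr0 subr0
  lerBlDr -addrA.
Qed.

Lemma smooth_ge0 (L : R) g : smooth L g -> 0 <= L.
Proof. by case. Qed.

Lemma smooth_sqr (L : R) g x y : smooth L g ->
  dot (grad g x - grad g y) (grad g x - grad g y) <= L ^+ 2 * dot (x - y) (x - y).
Proof.
case=> L_ge0 _ gradL; rewrite -!enorm_sqr -exprMn.
by rewrite ler_pXn2r ?nnegrE ?mulr_ge0 ?enorm_ge0.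
Qed.

Lemma grad_avg (n : nat) (f : 'I_n -> 'rV[R]_d -> R) x :
  (forall i, differentiable (f i) x) ->
  grad (avg f) x = n%:R^-1 *: \sum_(i < n) grad (f i) x.
Proof.
move=> df; apply/rowP => j; rewrite !mxE summxE.
have -> : avg f = n%:R^-1 *: \sum_(i < n) f i.
  by apply/funext => y; rewrite /avg !fctE fct_sumE.
rewrite deriveZ; last by apply: derivable_sum => i; apply: diff_derivable.
rewrite derive_sum; last by move=> i; apply: diff_derivable.
by congr (_ * _); apply: eq_bigr => i _; rewrite mxE.
Qed.

End Gradient.

(** * Moments of a random minibatch *)

Section SamplingMoments.
Context {R : realType} {n : nat} (mu : {set 'I_n} -> R).
Implicit Types (F G : {set 'I_n} -> R) (c : R).

Definition mean F : R := \sum_(A : {set 'I_n}) mu A * F A.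

Lemma meanD F G : mean (fun A => F A + G A) = mean F + mean G.
Proof. by rewrite -big_split; apply: eq_bigr => A _; rewrite mulrDr. Qed.

Lemma meanZ c F : mean (fun A => c * F A) = c * mean F.
Proof. by rewrite mulr_sumr; apply: eq_bigr => A _; rewrite mulrCA. Qed.

Lemma mean_sum_in (a : 'I_n -> R) :
  mean (fun A => \sum_(i in A) a i) = \sum_(i < n) inclusion_prob mu i * a i.
Proof.
rewrite /mean; under eq_bigr do rewrite mulr_sumr.
rewrite (exchange_big_dep xpredT)//=; apply: eq_bigr => i _.
by rewrite mulr_suml.
Qed.

Lemma expected_sizeE : expected_size mu = \sum_(i < n) inclusion_prob mu i.
Proof.
have -> : expected_size mu = mean (fun A => \sum_(i in A) 1).
  by apply: eq_bigr => A _; rewrite sumr_const.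
by rewrite mean_sum_in; apply: eq_bigr => i _; rewrite mulr1.
Qed.

Lemma cond_expected_size_le (i : 'I_n) :
  cond_expected_size mu i <= max_cond_expected_size mu.
Proof. exact: (le_bigmax 0 (cond_expected_size mu)). Qed.

Hypothesis hmu : sampling_distribution mu.

Lemma mean_cst c : mean (fun=> c) = c.
Proof. by rewrite /mean -mulr_suml hmu.2 mul1r. Qed.

Lemma mean_le F G : (forall A, F A <= G A) -> mean F <= mean G.
Proof. by move=> FG; apply: ler_sum => A _; rewrite ler_wpM2l// hmu.1. Qed.

Lemma inclusion_prob_le1 i : inclusion_prob mu i <= 1.
Proof.
rewrite -hmu.2 [leRHS](bigID (fun A : {set 'I_n} => i \in A))/= lerDl.
by apply: sumr_ge0 => A _; apply: hmu.1.
Qed.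

(** Given i \in S, the minibatch S is nonempty. *)
Lemma max_cond_expected_size_ge1 (i : 'I_n) :
  proper_sampling mu -> 1 <= max_cond_expected_size mu.
Proof.
move=> hproper; apply: le_trans (cond_expected_size_le i).
rewrite ler_pdivlMr// mul1r; apply: ler_sum => A iA.
by rewrite ler_peMr ?hmu.1// ler1n card_gt0; apply/set0Pn; exists i.
Qed.

(** Exchanging the sums, the weight of a i is E[|S|; i \in S], which is the
    conditional mean of |S| times the inclusion probability of i. *)
Lemma mean_sized_sum_le (a : 'I_n -> R) :
  proper_sampling mu -> (forall i, 0 <= a i) ->
  mean (fun A => #|A|%:R * \sum_(i in A) a i) <=
  max_cond_expected_size mu * \sum_(i < n) inclusion_prob mu i * a i.
Proof.
move=> hproper a_ge0; rewrite /mean.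
under eq_bigr do rewrite mulrA mulr_sumr.
rewrite (exchange_big_dep xpredT)//= mulr_sumr; apply: ler_sum => i _.
rewrite -mulr_suml mulrA ler_wpM2r//.
by rewrite -ler_pdivrMr// cond_expected_size_le.
Qed.

End SamplingMoments.

(** With s the sum and m the number of its terms, the sum of the |m v_i - s|^2
    is m times the difference of the two sides. *)
Lemma dot_sum_le {R : realType} {d n : nat} (A : {set 'I_n})
    (v : 'I_n -> 'rV[R]_d) :
  dot (\sum_(i in A) v i) (\sum_(i in A) v i) <=
  #|A|%:R * \sum_(i in A) dot (v i) (v i).
Proof.
set s := \sum_(i in A) v i.
have [A0|A_gt0] := posnP #|A|.
  have s0 : s = 0.
    by rewrite /s (cards0_eq A0) big_set0.
  by rewrite s0 dot0r A0 mul0r.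
have c_gt0 : 0 < #|A|%:R :> R by rewrite ltr0n.
have : 0 <= \sum_(i in A) dot (#|A|%:R *: v i - s) (#|A|%:R *: v i - s).
  by apply: sumr_ge0 => i _; apply: dotuu_ge0.
have -> : \sum_(i in A) dot (#|A|%:R *: v i - s) (#|A|%:R *: v i - s) =
    #|A|%:R * (#|A|%:R * (\sum_(i in A) dot (v i) (v i)) - dot s s).
  transitivity (\sum_(i in A) (#|A|%:R ^+ 2 * dot (v i) (v i) +
     (- 2 * #|A|%:R) * dot s (v i) + dot s s)).
    apply: eq_bigr => i _; rewrite !(dotBl, dotBr, dotZl, dotZr) (dotC (v i) s).
    ring.
  rewrite !big_split/= -!mulr_sumr -dot_sumr -/s sumr_const -mulr_natl.
  ring.
by rewrite pmulr_rge0// subr_ge0.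
Qed.

(** * One update of the state *)

Section OneStep.
Context {R : realType} {n d : nat} (n_gt0 : (0 < n)%N).
Context (f : 'I_n -> 'rV[R]_d -> R) (L gamma : R).
Hypothesis hfi : forall i, smooth L (f i).
Context (mu : {set 'I_n} -> R) (p A B : R).
Hypotheses (hmu : sampling_distribution mu) (p_gt0 : 0 < p).
Hypothesis (mu_p : forall i, inclusion_prob mu i = p).
Hypothesis A_ge0 : 0 <= A.
Hypothesis hAB : sampling_variance_bound mu d A B.
Context (phi : 'I_n -> 'rV[R]_d).

Local Notation x := (miso_point f gamma phi).
Local Notation gradx := (grad (avg f) x).
Local Notation M := (max_cond_expected_size mu).

Definition miso_update (phi' : 'I_n -> 'rV[R]_d) (S : {set 'I_n}) (i : 'I_n) :
    'rV[R]_d :=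
  if i \in S then miso_point f gamma phi' else phi' i.

Definition miso_gap (i : 'I_n) : 'rV[R]_d := x - phi i.

(** The contribution of index i to n times the increment of the iterate, when i
    is sampled. *)
Definition miso_move (i : 'I_n) : 'rV[R]_d :=
  miso_gap i - gamma *: (grad (f i) x - grad (f i) (phi i)).

Definition miso_shift (S : {set 'I_n}) : 'rV[R]_d :=
  n%:R^-1 *: \sum_(i in S) miso_move i.

Let n_neq0 : n%:R != 0 :> R. Proof. by rewrite pnatr_eq0 -lt0n. Qed.

Let n_gt0R : 0 < n%:R :> R. Proof. by rewrite ltr0n. Qed.

Lemma miso_point_update S :
  miso_point f gamma (miso_update phi S) = x + miso_shift S.
Proof.
have sumE (F : 'I_n -> 'rV[R]_d -> 'rV[R]_d) :
    \sum_i F i (miso_update phi S i) =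
    \sum_i F i (phi i) + \sum_(i in S) (F i x - F i (phi i)).
  rewrite [X in _ + X]big_mkcond -big_split; apply: eq_bigr => i _.
  by rewrite /miso_update; case: ifP => _ /=; rewrite ?addr0// addrCA subrr addr0.
rewrite {1}/miso_point (sumE (fun=> id)) (sumE (fun i => grad (f i))).
have -> : miso_shift S = n%:R^-1 *: (\sum_(i in S) (x - phi i) -
    gamma *: \sum_(i in S) (grad (f i) x - grad (f i) (phi i))).
  by rewrite scaler_sumr -sumrB.
have regroup (a b c e : 'rV[R]_d) :
    n%:R^-1 *: (a + b) - (gamma / n%:R) *: (c + e) =
    n%:R^-1 *: a - (gamma / n%:R) *: c + n%:R^-1 *: (b - gamma *: e).
  by apply/rowP => j; rewrite !mxE; ring.
by rewrite regroup.
Qed.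

(** By definition n x is the sum of the phi_i - gamma f_i'(phi_i), so all the
    terms in phi cancel. *)
Lemma sum_miso_move : \sum_i miso_move i = - (gamma * n%:R) *: gradx.
Proof.
rewrite grad_avg; last by move=> i; case: (hfi i).
rewrite scalerA mulNr -mulrA divff// mulr1.
have -> : \sum_i miso_move i = (x *+ n - \sum_i phi i) -
    gamma *: (\sum_i grad (f i) x - \sum_i grad (f i) (phi i)).
  rewrite /miso_move big_split/= sumrN -scaler_sumr.
  congr (_ - _ *: _); last exact: sumrB.
  by rewrite /miso_gap big_split/= sumr_const card_ord sumrN.
have -> : x *+ n = \sum_i phi i - gamma *: \sum_i grad (f i) (phi i).
  rewrite -scaler_nat /miso_point scalerBr !scalerA.
  by rewrite mulrCA !divff// mulr1 scale1r.
by rewrite (addrAC (\sum_i phi i)) subrr add0r scalerBr opprB addrA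
  addNr add0r scaleNr.
Qed.

Lemma mean_miso_shift u :
  mean mu (fun S => dot u (miso_shift S)) = - (gamma * p * dot u gradx).
Proof.
have -> : (fun S => dot u (miso_shift S)) =
    (fun S => n%:R^-1 * \sum_(i in S) dot u (miso_move i)).
  by apply/funext => S; rewrite /miso_shift dotZr dot_sumr.
rewrite meanZ mean_sum_in.
under eq_bigr do rewrite mu_p.
rewrite -mulr_sumr -dot_sumr sum_miso_move dotZr.
by field.
Qed.

Lemma dot_miso_move_le i : dot (miso_move i) (miso_move i) <=
  2 * (1 + gamma ^+ 2 * L ^+ 2) * dot (miso_gap i) (miso_gap i).
Proof.
rewrite /miso_move; set e := grad _ x - _.
have : dot e e <= L ^+ 2 * dot (miso_gap i) (miso_gap i) by apply: smooth_sqr.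
move=> /(ler_wpM2l (sqr_ge0 gamma)) e_le.
apply: le_trans (sqr_dotB_le _ _) _.
by rewrite dotZl dotZr; lra.
Qed.

Definition mean_gap : R := n%:R^-1 * \sum_i dot (miso_gap i) (miso_gap i).

Let sum_gapE : \sum_i dot (miso_gap i) (miso_gap i) = n%:R * mean_gap.
Proof. by rewrite /mean_gap mulrA divff// mul1r. Qed.

Definition mean_sqr_shift : R :=
  mean mu (fun S => dot (miso_shift S) (miso_shift S)).

Lemma mean_sqr_shift_ge0 : 0 <= mean_sqr_shift.
Proof. by apply: sumr_ge0 => S _; rewrite mulr_ge0 ?dotuu_ge0 ?hmu.1. Qed.

(** The variance hypothesis for the moves: their sum is - gamma n times the
    gradient, and each move has square norm at most 2 (1 + gamma^2 L^2) |v_i|^2. *)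
Lemma mean_sqr_shift_le : mean_sqr_shift <=
  2 * (1 + gamma ^+ 2 * L ^+ 2) * p * (p * A / n%:R) * mean_gap +
  B * gamma ^+ 2 * p ^+ 2 * dot gradx gradx.
Proof.
have p_neq0 : p != 0 by rewrite gt_eqF.
have := hAB miso_move.
have -> : \sum_S mu S *
    enorm (\sum_(i in S) (inclusion_prob mu i)^-1 *: miso_move i) ^+ 2 = (n%:R / p) ^+ 2 * mean_sqr_shift.
  rewrite /mean_sqr_shift -meanZ; apply: eq_bigr => S _; congr (_ * _).
  under eq_bigr do rewrite mu_p.
  rewrite -scaler_sumr enorm_sqr /miso_shift !(dotZl, dotZr); field.
  by rewrite n_neq0 p_neq0.
rewrite sum_miso_move enorm_sqr dotZl dotZr => h.
have {h} : mean_sqr_shift <= (p / n%:R) ^+ 2 *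
   (A * (\sum_i enorm (miso_move i) ^+ 2) +
    B * (- (gamma * n%:R) * (- (gamma * n%:R) * dot gradx gradx))).
  have -> : mean_sqr_shift = (p / n%:R) ^+ 2 * ((n%:R / p) ^+ 2 * mean_sqr_shift).
    by field; rewrite n_neq0 p_neq0.
  by rewrite ler_wpM2l// sqr_ge0.
move=> shift_le; apply: le_trans shift_le _.
have moves : \sum_i enorm (miso_move i) ^+ 2 <=
    2 * (1 + gamma ^+ 2 * L ^+ 2) * (n%:R * mean_gap).
  rewrite -sum_gapE mulr_sumr.
  by apply: ler_sum => i _; rewrite enorm_sqr dot_miso_move_le.
have := ler_wpM2l (mulr_ge0 (sqr_ge0 (p / n%:R)) A_ge0) moves.
rewrite [leRHS](_ : _ = 2 * (1 + gamma ^+ 2 * L ^+ 2) * p * (p * A / n%:R) *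
  mean_gap); last by field.
move=> gaps; rewrite mulrDr mulrA; apply: lerD => //.
by rewrite le_eqVlt; apply/predU1l; field.
Qed.

(** The value of mean_gap after the update with minibatch S, written with the
    increment of the iterate made explicit (see miso_point_update). *)
Definition gap_after (S : {set 'I_n}) : R :=
  n%:R^-1 * \sum_i dot (x + miso_shift S - miso_update phi S i)
                       (x + miso_shift S - miso_update phi S i).

(** An index outside S has new gap v_i + D and an index in S has new gap D. The
    sum over the complement of S is written as a full sum minus a sum over S, since
    the mean of a full sum against D is known exactly. *)
Lemma gap_afterE S : gap_after S =
  dot (miso_shift S) (miso_shift S) + mean_gap
  + n%:R^-1 * (2 * dot (\sum_i miso_gap i) (miso_shift S)
  - \sum_(i in S) dot (miso_gap i) (miso_gap i)
  - 2 * dot (\sum_(i in S) miso_gap i) (miso_shift S)).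
Proof.
set D := miso_shift S.
have -> : gap_after S = n%:R^-1 * \sum_i (dot D D + (
     dot (miso_gap i) (miso_gap i) + 2 * dot D (miso_gap i) -
     (if i \in S then dot (miso_gap i) (miso_gap i) + 2 * dot D (miso_gap i) else 0))).
  congr (_ * _); apply: eq_bigr => i _.
  rewrite /miso_update; case: ifP => _.
    by rewrite addrAC subrr add0r subrr addr0.
  rewrite (_ : x + _ - _ = miso_gap i + D); last by rewrite addrAC.
  by rewrite sqr_dotD; ring.
rewrite big_split/= sumr_const card_ord sumrB big_split/=.
rewrite -[X in _ - X]big_mkcond big_split/= -!mulr_sumr -!dot_sumr.
rewrite (dotC D) (dotC D) -mulr_natl /mean_gap; by field.
Qed.

Hypothesis hproper : proper_sampling mu.

(** Of the two cross terms of gap_afterE, the full sum only meets the mean of D,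
    which is - gamma p grad f(x), and costs p/2 of mean_gap by Young's inequality.
    The sum over S is paired with D by Young's inequality with weight (6 M)^-1, so that
    E[|S| sum_(i in S) |v_i|^2] <= M p sum |v_i|^2 makes it cost p/6 of
    mean_gap. *)
Lemma mean_gap_after_le : mean mu gap_after <=
  (1 + 6 * M / n%:R) * mean_sqr_shift + (1 - p / 3) * mean_gap
  + 2 * gamma ^+ 2 * p * dot gradx gradx.
Proof.
have M_ge1 : 1 <= M.
  by apply: (max_cond_expected_size_ge1 hmu (Ordinal n_gt0)).
have M_gt0 : 0 < M by apply: lt_le_trans M_ge1.
pose W := \sum_i miso_gap i.
pose V (S : {set 'I_n}) := \sum_(i in S) dot (miso_gap i) (miso_gap i).
pose D S := dot (miso_shift S) (miso_shift S).
(* The weight (6 M)^-1 on the sum over S is what leaves p/6 of mean_gap. *)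
have pointwise S : gap_after S <=
    (1 + 6 * M / n%:R) * D S + (mean_gap + ((2 / n%:R) * dot W (miso_shift S)
    + ((- n%:R^-1) * V S + (6 * M * n%:R)^-1 * (#|S|%:R * V S)))).
  rewrite gap_afterE -/W -/(V S) -/(D S).
  set s := \sum_(i in S) miso_gap i.
  have M6 : 0 < (6 * M)^-1 by rewrite invr_gt0 mulr_gt0.
  have := young (- s) (miso_shift S) M6.
  rewrite dotNl !dotNr dotNl opprK invrK -/(D S) => y1.
  have := ler_wpM2l (ltW M6) (dot_sum_le S miso_gap).
  rewrite -/s -/(V S) => y2.
  have y3 : - (2 * dot s (miso_shift S)) <=
      (6 * M)^-1 * (#|S|%:R * V S) + 6 * M * D S by lra.
  have n1 : 0 <= n%:R^-1 :> R by rewrite invr_ge0 ltW.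
  have := ler_wpM2l n1 y3.
  rewrite invfM; lra.
apply: le_trans (mean_le hmu pointwise) _.
rewrite !(meanD, meanZ) mean_cst//.
rewrite mean_miso_shift.
have -> : mean mu V = p * (n%:R * mean_gap).
  by rewrite mean_sum_in -sum_gapE mulr_sumr; apply: eq_bigr => i _; rewrite mu_p.
have sized := mean_sized_sum_le (mu := mu)
  (a := fun i => dot (miso_gap i) (miso_gap i))
  hproper (fun i => dotuu_ge0 _).
have {sized} : (6 * M * n%:R)^-1 * mean mu (fun S => #|S|%:R * V S) <=
    p / 6 * mean_gap.
  have c0 : 0 <= (6 * M * n%:R)^-1 by rewrite invr_ge0 !mulr_ge0// ltW.
  apply: le_trans (ler_wpM2l c0 sized) _.
  under eq_bigr do rewrite mu_p.
  rewrite -mulr_sumr sum_gapE le_eqVlt; apply/orP; left; apply/eqP; field.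
  by rewrite n_neq0 gt_eqF.
(* Young's inequality index by index; the weight 2 leaves 1/2 of mean_gap. *)
have cross : - (2 * gamma / n%:R * dot W gradx) <=
    2 * gamma ^+ 2 * dot gradx gradx + 2^-1 * mean_gap.
  have y i : - (2 * gamma) * dot gradx (miso_gap i) <=
      2 * gamma ^+ 2 * dot gradx gradx + 2^-1 * dot (miso_gap i) (miso_gap i).
    have := young (- gamma *: gradx) (miso_gap i) (ltr0Sn R 1).
    by rewrite !dotZl dotZr; lra.
  have := ler_sum (index_enum 'I_n) (fun i (_ : true) => y i).
  rewrite -mulr_sumr -dot_sumr -/W big_split/= sumr_const card_ord.
  rewrite -[_ * dot gradx gradx *+ n]mulr_natl -mulr_sumr sum_gapE dotC => sum_y.
  rewrite -(ler_pM2l n_gt0R).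
  have -> : n%:R * - (2 * gamma / n%:R * dot W gradx) = - (2 * gamma) * dot W gradx.
    by field.
  by lra.
have := ler_wpM2l (ltW p_gt0) cross.
rewrite -/mean_gap -/(mean mu D) -/mean_sqr_shift.
have -> : - n%:R^-1 * (p * (n%:R * mean_gap)) = - (p * mean_gap) by field.
lra.
Qed.

End OneStep.

(** * Stepsize conditions *)

Section Stepsize.
Context {R : realType}.
Implicit Types (num t c g : R).

(** Clearing a denominator in the extended reals. When t = 0 the quotient is +oo
    and carries no information, but the conclusion is then trivial; this is what lets
    all the stepsize conditions be used as polynomial inequalities over R. *)
Lemma lee_div_fin num t c : 0 <= num -> 0 <= t ->
  (c%:E <= num%:E / t%:E)%E -> c * t <= num.
Proof.
move=> num_ge0 t_ge0; have [->|t_neq0] := eqVneq t 0; first by rewrite mulr0.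
by rewrite inver (negPf t_neq0) -EFinM lee_fin ler_pdivlMr// lt_def t_neq0.
Qed.

Lemma lee_div_div_fin num t c g : 0 < num -> 0 <= t -> 0 <= c ->
  (g%:E <= num%:E / t%:E / c%:E)%E -> g * c * t <= num.
Proof.
move=> num_gt0 t_ge0 c_ge0; have [->|t_neq0] := eqVneq t 0.
  by move=> _; rewrite mulr0 ltW.
have t_gt0 : 0 < t by rewrite lt_def t_neq0.
rewrite inver (negPf t_neq0) -EFinM => step.
by rewrite -ler_pdivlMr// lee_div_fin// divr_ge0// ltW.
Qed.

Lemma powR_root_exp (m : nat) c : 0 <= c -> (0 < m)%N ->
  (c `^ (1 / m%:R)) ^+ m = c.
Proof.
move=> c_ge0 m_gt0; rewrite -powR_mulrn ?powR_ge0// -powRrM div1r mulVf ?powRr1//.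
by rewrite pnatr_eq0 -lt0n.
Qed.

Lemma lee_root_div_fin (m : nat) num t c g : (0 < m)%N ->
  0 < num -> 0 <= t -> 0 <= c -> 0 <= g ->
  (g%:E <= ((num%:E / t%:E) `^ (1 / m%:R)) / (c `^ (1 / m%:R))%:E)%E ->
  g ^+ m * c * t <= num.
Proof.
move=> m_gt0 num_gt0 t_ge0 c_ge0 g_ge0; have [->|t_neq0] := eqVneq t 0.
  by move=> _; rewrite mulr0 ltW.
have t_gt0 : 0 < t by rewrite lt_def t_neq0.
have ratio_ge0 : 0 <= num / t by rewrite divr_ge0// ltW.
rewrite inver (negPf t_neq0) -EFinM => /(lee_div_fin (powR_ge0 _ _) (powR_ge0 _ _)) gc.
rewrite -ler_pdivlMr// -{1}(powR_root_exp c_ge0 m_gt0) -exprMn.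
rewrite -[leRHS](powR_root_exp ratio_ge0 m_gt0).
by rewrite ler_pXn2r ?nnegrE ?mulr_ge0 ?powR_ge0.
Qed.

End Stepsize.

(** The bound on D is multiplied by Lf / 2 + alpha C, and alpha g q = 1/2. The G
    terms: g B Lf p <= 1/2 bounds the one with Lf, 2 B C <= q the one with alpha C,
    and q >= 4 the one from Young's inequality, each by g p / 4. The Phi terms: the
    four products of 2 r, of Lf / 2 or alpha C, and of 1 or g^2 L^2 are each at
    most alpha / 12, by the four hypotheses that contain the number 24. *)
Lemma lyapunov_balance {R : realFieldType} (Lf L B C K p r q alpha g : R)
    (D Phi G : R) :
  0 <= Lf -> 0 <= B -> 0 <= K -> K <= C -> 0 < p -> p <= 1 -> 0 < g ->
  0 <= D -> 0 <= Phi -> 0 <= G ->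
  4 <= q -> 2 * B * C <= q -> alpha = 1 / (2 * g) / q ->
  g * B * Lf * p <= 1 / 2 ->
  24 * C * r <= 1 ->
  24 * q * Lf * g * r <= 1 ->
  24 * q * Lf * L ^+ 2 * g ^+ 3 * r <= 1 ->
  24 * C * L ^+ 2 * g ^+ 2 * r <= 1 ->
  D <= 2 * (1 + g ^+ 2 * L ^+ 2) * p * r * Phi + B * g ^+ 2 * p ^+ 2 * G ->
  - (g * p * G) + Lf / 2 * D
    + alpha * (K * D + (1 - p / 3) * Phi + 2 * g ^+ 2 * p * G) <=
  alpha * Phi - g * p / 4 * G.
Proof.
move=> Lf0 B0 K0 KC p0 p1 g0 D0 Phi0 G0 q4 qBC alphaE s1 s0 s2 s3 s4 hD.
have q0 : 0 < q by lra.
have alpha0 : 0 < alpha by rewrite alphaE !divr_gt0// mulr_gt0.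
have agq : 2 * (alpha * g * q) = 1.
  by rewrite alphaE; field; rewrite !gt_eqF.
have ag : 8 * (alpha * g) <= 1.
  have := ler_wpM2l (ltW (mulr_gt0 alpha0 g0)) q4; lra.
have r2 : 12 * (Lf * r) <= alpha.
  have := ler_wpM2l (ltW alpha0) s2.
  rewrite (_ : alpha * _ = 12 * (Lf * r) * (2 * (alpha * g * q))); last by ring.
  by rewrite agq !mulr1.
have r3 : 12 * (Lf * g ^+ 2 * L ^+ 2 * r) <= alpha.
  have := ler_wpM2l (ltW alpha0) s3.
  rewrite (_ : alpha * _ = 12 * (Lf * g ^+ 2 * L ^+ 2 * r) * (2 * (alpha * g * q)));
    last by ring.
  by rewrite agq !mulr1.
have r0 := ler_wpM2l (ltW alpha0) s0.
have r4 := ler_wpM2l (ltW alpha0) s4.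
have gap_coef : (Lf / 2 + alpha * C) * (2 * (1 + g ^+ 2 * L ^+ 2) * r) <= alpha / 3.
  lra.
have gp0 : 0 < g * p by rewrite mulr_gt0.
have f_coef : Lf / 2 * (B * g ^+ 2 * p ^+ 2) <= g * p / 4.
  have := ler_wpM2l (ltW gp0) s1; lra.
have lyap_coef : alpha * C * (B * g ^+ 2 * p ^+ 2) <= g * p / 4.
  have agp0 : 0 <= alpha * g * (g * p ^+ 2).
    by rewrite !mulr_ge0// ?sqr_ge0// ltW.
  have := ler_wpM2l agp0 qBC.
  rewrite (_ : alpha * g * (g * p ^+ 2) * q =
    2 * (alpha * g * q) * (g * p ^+ 2) / 2); last by field.
  rewrite agq.
  have := ler_wpM2l (ltW gp0) p1; lra.
have young_coef : alpha * (2 * g ^+ 2 * p) <= g * p / 4.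
  have := ler_wpM2l (ltW gp0) ag; lra.
have coef0 : 0 <= Lf / 2 + alpha * C.
  by rewrite addr_ge0 ?divr_ge0// mulr_ge0 ?(ltW alpha0)// (le_trans K0).
have h1 : alpha * K * D <= alpha * C * D.
  by rewrite ler_wpM2r// ler_wpM2l// ltW.
have h2 := ler_wpM2l coef0 hD.
have h3 := ler_wpM2r (mulr_ge0 (ltW p0) Phi0) gap_coef.
have h4 := ler_wpM2r G0 f_coef.
have h5 := ler_wpM2r G0 lyap_coef.
have h6 := ler_wpM2r G0 young_coef.
lra.
Qed.

(** * Expected decrease for a fixed state *)

Definition miso_lyapunov (R : realType) (n d : nat) (f : 'I_n -> 'rV[R]_d -> R)
    (gamma alpha : R) (phi : 'I_n -> 'rV[R]_d) : R :=
  avg f (miso_point f gamma phi) + alpha *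
  (n%:R^-1 * \sum_(i < n) enorm (miso_point f gamma phi - phi i) ^+ 2).

Lemma miso_expected_decrease (R : realType) (n d : nat) (n_gt0 : (0 < n)%N)
    (f : 'I_n -> 'rV[R]_d -> R) (Lf L : R)
    (hf : smooth Lf (avg f)) (hfi : forall i, smooth L (f i))
    (mu : {set 'I_n} -> R) (hmu : sampling_distribution mu)
    (hproper : proper_sampling mu) (p A B : R)
    (mu_p : forall i, inclusion_prob mu i = p) (A_ge0 : 0 <= A) (B_ge0 : 0 <= B)
    (hAB : sampling_variance_bound mu d A B) (C q gamma alpha : R)
    (C_ge : 1 + 6 * max_cond_expected_size mu / n%:R <= C)
    (q_ge4 : 4 <= q) (q_geBC : 2 * B * C <= q) (gamma_gt0 : 0 < gamma)
    (alphaE : alpha = 1 / (2 * gamma) / q)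
    (step1 : gamma * B * Lf * p <= 1 / 2)
    (cond : 24 * C * (p * A / n%:R) <= 1)
    (step2 : 24 * q * Lf * gamma * (p * A / n%:R) <= 1)
    (step3 : 24 * q * Lf * L ^+ 2 * gamma ^+ 3 * (p * A / n%:R) <= 1)
    (step4 : 24 * C * L ^+ 2 * gamma ^+ 2 * (p * A / n%:R) <= 1)
    (phi : 'I_n -> 'rV[R]_d) :
  mean mu (fun S => miso_lyapunov f gamma alpha (miso_update f gamma phi S)) <=
  miso_lyapunov f gamma alpha phi -
  gamma * p / 4 * enorm (grad (avg f) (miso_point f gamma phi)) ^+ 2.
Proof.
set x := miso_point f gamma phi; set G := grad (avg f) x.
have p_gt0 : 0 < p by rewrite -(mu_p (Ordinal n_gt0)).
have p_le1 : p <= 1 by rewrite -(mu_p (Ordinal n_gt0)) inclusion_prob_le1.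
have alpha_ge0 : 0 <= alpha.
  by rewrite alphaE !divr_ge0 ?mulr_ge0 ?(ltW gamma_gt0)// (le_trans _ q_ge4).
have M_ge0 : 0 <= max_cond_expected_size mu.
  exact: le_trans ler01 (max_cond_expected_size_ge1 hmu (Ordinal n_gt0) hproper).
have pointwise S : miso_lyapunov f gamma alpha (miso_update f gamma phi S) <=
    avg f x + (dot G (miso_shift f gamma phi S)
    + (Lf / 2 * dot (miso_shift f gamma phi S) (miso_shift f gamma phi S)
    + alpha * gap_after f gamma phi S)).
  rewrite /miso_lyapunov miso_point_update// -/x.
  under eq_bigr do rewrite enorm_sqr.
  rewrite -/(gap_after f gamma phi S).
  have := smooth_descent x (x + miso_shift f gamma phi S) hf.
  by rewrite [x + _]addrC addrK -/G; lra.
apply: le_trans (mean_le hmu pointwise) _.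
rewrite 3!meanD mean_cst// 2!meanZ (mean_miso_shift n_gt0 _ hfi mu_p) -/x -/G.
have := mean_gap_after_le n_gt0 gamma hfi hmu p_gt0 mu_p phi hproper.
rewrite -/x -/G => /(ler_wpM2l alpha_ge0) lyap.
have K_ge0 : 0 <= 1 + 6 * max_cond_expected_size mu / n%:R.
  by rewrite addr_ge0 ?divr_ge0 ?mulr_ge0.
have gap_ge0 : 0 <= mean_gap f gamma phi.
  by rewrite mulr_ge0 ?invr_ge0// sumr_ge0// => i _; rewrite dotuu_ge0.
have := lyapunov_balance (smooth_ge0 hf) B_ge0 K_ge0 C_ge p_gt0 p_le1 gamma_gt0
  (mean_sqr_shift_ge0 f gamma hmu phi) gap_ge0 (dotuu_ge0 G) q_ge4 q_geBC alphaE
  step1 cond step2 step3 step4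
  (mean_sqr_shift_le n_gt0 gamma hfi p_gt0 mu_p A_ge0 hAB phi).
have -> : miso_lyapunov f gamma alpha phi = avg f x + alpha * mean_gap f gamma phi.
  rewrite /miso_lyapunov; congr (_ + _ * (_ * _)).
  by apply: eq_bigr => i _; rewrite enorm_sqr.
by rewrite enorm_sqr -/(mean_sqr_shift f gamma mu phi); lra.
Qed.

(** * Conditional expectation given a finite-valued state *)

Section FiniteConditioning.
Context {R : realType} {disp : measure_display} {T : measurableType disp}
        (P : probability T R).

Section FiniteVariable.
Context {Y : finType} (y : T -> Y).
Hypothesis y_meas : forall v, measurable (y @^-1` [set v]).

Lemma finite_variableE (u : Y -> R) w :
  (u (y w))%:E = (\sum_(v : Y) (u v)%:E * (\1_(y @^-1` [set v]) w)%:E)%E.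
Proof.
rewrite (bigD1 (y w))//= big1 ?adde0 => [|v v_neq]; rewrite indicE.
  by rewrite mem_set// mule1.
by rewrite memNset ?mule0// => yv; rewrite yv eqxx in v_neq.
Qed.

Let indic_integrable (D : set T) v (c : R) : measurable D ->
  P.-integrable D (fun w => c%:E * (\1_(y @^-1` [set v]) w)%:E)%E.
Proof.
move=> mD; apply: integrableZl => //.
by apply: (integrableS measurableT) => //; apply: integrable_indic.
Qed.

Lemma integrable_finite_variable (u : Y -> R) :
  P.-integrable setT (EFin \o (u \o y)).
Proof.
rewrite (_ : _ \o _ =
  fun w => \sum_(v : Y) (u v)%:E * (\1_(y @^-1` [set v]) w)%:E)%E.
  by apply: integrable_sum => // v _; apply: indic_integrable.
by apply/funext => w; rewrite -finite_variableE.
Qed.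

Lemma integral_finite_variable (u : Y -> R) (D : set T) : measurable D ->
  (\int[P]_(w in D) (u (y w))%:E =
   \sum_(v : Y) (u v)%:E * P (y @^-1` [set v] `&` D))%E.
Proof.
move=> mD; under eq_integral do rewrite finite_variableE.
rewrite integral_sum//; last by move=> v; apply: indic_integrable.
apply: eq_bigr => v _; rewrite integralZl//.
  by rewrite integral_indic.
by apply: (integrableS measurableT) => //; apply: integrable_indic.
Qed.

End FiniteVariable.

Section StateAndDraw.
Context {H F : finType} {X : Type} (h : T -> H) (s : T -> F) (m : H -> X).
Context (mu : F -> R) (G : set (set T)) (Q : X -> F -> R).
Hypotheses (h_meas : forall v, measurable (h @^-1` [set v]))
           (s_meas : forall a, measurable (s @^-1` [set a])).
Hypothesis (indep : forall v a,
  P (s @^-1` [set a] `&` h @^-1` [set v]) = ((mu a)%:E * P (h @^-1` [set v]))%E).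
Hypothesis GE : G = [set (m \o h) @^-1` V | V in setT].

Definition averaged_draw (w : T) : R := \sum_(a : F) mu a * Q (m (h w)) a.

Lemma state_set_meas V : measurable ((m \o h) @^-1` V).
Proof.
rewrite (_ : _ @^-1` V = \bigcup_(v in [set v | V (m v)]) h @^-1` [set v]).
  by apply: fin_bigcup_measurable => // *; apply: finite_finset.
by apply/seteqP; split => [w Vw|w [v /= Vv ->]//]; exists (h w).
Qed.

(** On a set of the form (m o h)^-1 V both integrals are finite sums over the
    histories v with m v in V, and independence turns the joint probabilities of
    history and draw into products. *)
Lemma averaged_draw_cond_expectation :
  is_cond_expectation P G (fun w => Q (m (h w)) (s w)) averaged_draw.
Proof.
pose hs w := (h w, s w).
have hsE va : hs @^-1` [set va] = s @^-1` [set va.2] `&` h @^-1` [set va.1].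
  case: va => v a; apply/seteqP; split => w /=; first by case=> -> ->.
  by case=> sE hE; rewrite /hs sE hE.
have hs_meas va : measurable (hs @^-1` [set va]).
  by rewrite hsE; apply: measurableI.
split.
- exact: (integrable_finite_variable hs_meas (fun va => Q (m va.1) va.2)).
- exact: (integrable_finite_variable h_meas
    (fun v => \sum_(a : F) mu a * Q (m v) a)).
- move=> B _; rewrite GE.
  by exists [set z | B (\sum_(a : F) mu a * Q z a)].
rewrite GE => _ [V _ <-]; have mV := state_set_meas V.
rewrite (integral_finite_variable h_meas (fun v => \sum_(a : F) mu a * Q (m v) a) mV).
rewrite (integral_finite_variable hs_meas (fun va => Q (m va.1) va.2) mV).
rewrite (eq_bigr (fun va => (fun v a => (Q (m v) a)%:E *
   P (hs @^-1` [set (v, a)] `&` (m \o h) @^-1` V))%E va.1 va.2)); last by case.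
rewrite -(pair_bigA _ (fun v a => (Q (m v) a)%:E *
   P (hs @^-1` [set (v, a)] `&` (m \o h) @^-1` V))%E)/=.
apply: eq_bigr => v _; have [Vv|nVv] := pselect (V (m v)).
  have hV : h @^-1` [set v] `<=` (m \o h) @^-1` V by move=> w /= ->.
  rewrite (setIidl hV) -(fineK (fin_num_measure P _ (h_meas v))) -EFinM mulr_suml.
  rewrite -sumEFin; apply: eq_bigr => a _.
  have -> : hs @^-1` [set (v, a)] `&` (m \o h) @^-1` V =
      s @^-1` [set a] `&` h @^-1` [set v].
    by rewrite hsE/= -setIA (setIidl hV).
  rewrite indep -[in RHS](fineK (fin_num_measure P _ (h_meas v))) -!EFinM.
  by congr (_%:E); ring.
have hV : h @^-1` [set v] `&` (m \o h) @^-1` V = set0.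
  by apply/seteqP; split => // w [/= ->].
rewrite hV measure0 mule0 big1// => a _.
by rewrite hsE/= -setIA hV setI0 measure0 mule0.
Qed.

(** Both versions are constant on every fibre of the state. A fibre belongs to
    G, so the two constants agree unless the fibre is null, and there are finitely
    many fibres. *)
Lemma cond_expectation_unique (Y Z1 Z2 : T -> R) :
  is_cond_expectation P G Y Z1 -> is_cond_expectation P G Y Z2 ->
  {ae P, forall w, Z1 w = Z2 w}.
Proof.
move=> [_ int1 G1 eq1] [_ int2 G2 eq2].
(* The preimage of the singleton [set Z w] is in G, hence a union of fibres. *)
have fibre (Z : T -> R) : (forall B : set R, measurable B -> G (Z @^-1` B)) ->
    forall w w', m (h w) = m (h w') -> Z w' = Z w.
  move=> GZ w w' ww'; have := GZ [set Z w] (measurable_set1 _).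
  rewrite GE => -[V _ VE].
  have VZ u : V (m (h u)) = (Z u = Z w) := congr1 (fun D : set T => D u) VE.
  by rewrite -VZ -ww' VZ.
have null v : P.-negligible
    ([set w | Z1 w <> Z2 w] `&` (m \o h) @^-1` [set m v]).
  have mfib := state_set_meas [set m v].
  have Gfib : G ((m \o h) @^-1` [set m v]) by rewrite GE; exists [set m v].
  have [[w0 [/= Z12 mw0]]|none] := pselect (exists w,
    ([set w | Z1 w <> Z2 w] `&` (m \o h) @^-1` [set m v]) w); last first.
    rewrite (_ : _ `&` _ = set0); first exact: negligible_set0.
    by apply/seteqP; split => // w ?; apply: none; exists w.
  apply: (negligibleS (@subIsetr _ _ _)).
  apply/negligibleP => //.
  have constant (Z : T -> R) : (forall B : set R, measurable B -> G (Z @^-1` B)) ->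
      (\int[P]_(w in (m \o h) @^-1` [set m v]) (Z w)%:E =
       (Z w0)%:E * P ((m \o h) @^-1` [set m v]))%E.
    move=> GZ; rewrite -integral_cst//; apply: eq_integral => w.
    by rewrite inE /= => mw; rewrite (fibre Z GZ w0 w)// mw0 mw.
  have := eq1 _ Gfib; rewrite -(eq2 _ Gfib) !constant//.
  have Pfin := fineK (fin_num_measure P _ mfib).
  rewrite -Pfin -!EFinM => -[] /eqP.
  rewrite -subr_eq0 -mulrBl mulf_eq0 subr_eq0 => /orP[/eqP/Z12//|/eqP P0].
  by apply: (etrans (esym Pfin)); rewrite P0.
have : P.-negligible (\bigcup_(v in [set: H])
    ([set w | Z1 w <> Z2 w] `&` (m \o h) @^-1` [set m v])).
  rewrite (_ : setT = [set` xpredT]); last by apply/seteqP.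
  rewrite bigcup_pred; elim/big_ind: _ => //; first exact: negligible_set0.
  by move=> N1 N2; apply: negligibleU.
by apply: negligibleS => w /= Zw; exists (h w).
Qed.

End StateAndDraw.
End FiniteConditioning.

(** * The history of the draws and the generated sigma-algebra *)

Section History.
Context {R : realType} {disp : measure_display} {T : measurableType disp}
        (P : probability T R) {n : nat} (mu : {set 'I_n} -> R)
        (S : nat -> T -> {set 'I_n}).
Hypothesis hS : independent_draws P mu S.

Definition draw_history (k : nat) (w : T) : {ffun 'I_k -> {set 'I_n}} :=
  [ffun j : 'I_k => S j w].

(** Trajectories are driven by infinite sequences of draws, whence this completion;
    up to time k they only see the first k draws (miso_phi_history). *)
Definition extend_history (k : nat) (v : {ffun 'I_k -> {set 'I_n}}) (l : nat) :
    {set 'I_n} :=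
  if insub l is Some j then v j else finset.set0.

Lemma extend_historyE k (v : {ffun 'I_k -> {set 'I_n}}) (j : 'I_k) :
  extend_history v j = v j.
Proof. by rewrite /extend_history valK. Qed.

Lemma draw_history_preimage k v : draw_history k @^-1` [set v] =
  [set w | forall j, (j < k)%N -> S j w = extend_history v j].
Proof.
apply/seteqP; split => w /=.
  move=> <- j jk; rewrite -[j]/(nat_of_ord (Ordinal jk)) extend_historyE.
  by rewrite ffunE.
by move=> Sv; apply/ffunP => j; rewrite ffunE Sv// extend_historyE.
Qed.

Lemma draw_measurable k A : measurable (S k @^-1` [set A]).
Proof. by case: (hS k A). Qed.

Lemma draw_history_measurable k v : measurable (draw_history k @^-1` [set v]).
Proof.
rewrite draw_history_preimage (_ : mkset _ =
    \bigcap_(j in [set: 'I_k]) S j @^-1` [set extend_history v j]).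
  apply: fin_bigcap_measurable; first exact: finite_finset.
  by move=> j _; apply: draw_measurable.
apply/seteqP; split => w /= Sw; first by move=> j _; apply: Sw.
by move=> j jk; apply: (Sw (Ordinal jk)).
Qed.

Lemma draw_history_indep k v A :
  P (S k @^-1` [set A] `&` draw_history k @^-1` [set v]) =
  ((mu A)%:E * P (draw_history k @^-1` [set v]))%E.
Proof.
rewrite draw_history_preimage.
by have [_ PA ->] := hS k A; rewrite PA.
Qed.

End History.

Lemma miso_phi_history (R : realType) (n d : nat) (f : 'I_n -> 'rV[R]_d -> R)
    (gamma : R) (phi0 : 'I_n -> 'rV[R]_d) (s s' : nat -> {set 'I_n}) (k : nat) :
  (forall j, (j < k)%N -> s j = s' j) ->
  miso_phi f gamma phi0 s k = miso_phi f gamma phi0 s' k.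
Proof.
elim: k => //= k IHk ss'.
by rewrite (IHk (fun j jk => ss' j (ltnW jk))) ss'.
Qed.

Section SigmaState.
Context {R : realType} {disp : measure_display} {T : measurableType disp}.
Context {n d : nat} {H : finType} (h : T -> H) (m : H -> 'I_n -> 'rV[R]_d)
        (point : ('I_n -> 'rV[R]_d) -> 'rV[R]_d).

(** The preimages under the state form a sigma-algebra that contains the
    generators. Conversely a preimage is a finite union of fibres, and a fibre is a
    finite intersection of preimages of points, which are closed. *)
Lemma sigma_state_finite :
  sigma_state (fun w => point (m (h w))) (fun i w => m (h w) i) =
  [set (m \o h) @^-1` V | V in setT].
Proof.
apply/seteqP; split.
  apply: smallest_sub.
    split; first by exists set0.
      by move=> _ [V _ <-]; exists (~` V) => //; rewrite setTD.
    move=> D DE; have /choice[V VE] k : exists V, (m \o h) @^-1` V = D k.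
      by have [V _ <-] := DE k; exists V.
    exists (\bigcup_k V k) => //.
    by rewrite preimage_bigcup; apply: eq_bigcup.
  move=> _ [[U _ <-]|[i _ [U _ <-]]]; first by exists (point @^-1` U).
  by exists [set phi : 'I_n -> 'rV[R]_d | U (phi i)].
move=> _ [V _ <-].
rewrite /sigma_state.
set Gen := (X in <<s X >>).
have -> : (m \o h) @^-1` V = \bigcup_(v in [set v | V (m v)])
    \bigcap_(i in [set: 'I_n]) (fun w => m (h w) i) @^-1` [set m v i].
  apply/seteqP; split => w /=; first by move=> Vw; exists (h w).
  move=> [v /= Vv hv]; suff -> : m (h w) = m v by [].
  by apply/funext => i; apply: hv.
rewrite -[<<s Gen >>]/(@measurable _ (g_sigma_algebraType Gen)).
apply: fin_bigcup_measurable; first exact: finite_finset.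
move=> v _; apply: fin_bigcap_measurable; first exact: finite_finset.
move=> i _; rewrite -[X in measurable X]setCK; apply: measurableC.
apply: sub_sigma_algebra; right; exists i => //.
exists (~` [set m v i]) => //.
apply: closed_openC; apply: accessible_closed_set1.
by apply: hausdorff_accessible; apply: norm_hausdorff.
Qed.

End SigmaState.

(** * Minibatch MISO *)

(* In \bar R the library sets 0^-1 = +oo, so the divisions in \bar R below
   implement the convention that a fraction with zero denominator is +oo
   (all numerators are positive). *)
Theorem theorem6p3 (R : realType) (n d : nat) (hn : (0 < n)%N)
    (f : 'I_n -> 'rV[R]_d -> R) (Lf L : R)
    (hf : smooth Lf (avg f)) (hfi : forall i, smooth L (f i))
    (hbounded : has_lbound (range (avg f)))
    (hmin : [set x | forall y, avg f x <= avg f y] !=set0)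
    (mu : {set 'I_n} -> R) (hmu : sampling_distribution mu)
    (hproper : proper_sampling mu) (huniform : uniform_sampling mu)
    (A B : R) (hA : 0 <= A) (hB : 0 <= B)
    (hAB : sampling_variance_bound mu d A B)
    (tau M q beta alpha gamma : R) (rho : \bar R)
    (htau : tau = expected_size mu)
    (hM : M = max_cond_expected_size mu)
    (hrho : rho = ((n%:R ^+ 2)%:E / (tau * A)%:E)%E)
    (hcond : ((24 * (6 * M / tau + 1))%:E <= rho)%E)
    (hq : q = Num.max 4 (2 * B * (6 * M / tau + 1)))
    (hgamma : 0 < gamma)
    (hbeta : beta = 1 / (2 * gamma))
    (halpha : alpha = beta / q)
    (hstep : (gamma%:E <=
       Order.min (n%:R%:E / (2 * B * Lf * tau)%:E)
      (Order.min (rho / (24 * q * Lf)%:E)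
      (Order.min ((rho `^ (1 / 3)) / ((24 * q * Lf * L ^+ 2) `^ (1 / 3))%:E)
                 ((rho `^ (1 / 2)) /
                  ((24 * (6 * M / tau + 1) * L ^+ 2) `^ (1 / 2))%:E))))%E)
    (phi0 : 'I_n -> 'rV[R]_d)
    (disp : measure_display) (T : measurableType disp) (P : probability T R)
    (S : nat -> T -> {set 'I_n}) (hS : independent_draws P mu S) (k : nat) :
  let x j w := miso_x f gamma phi0 (fun l => S l w) j in
  let phi j i w := miso_phi f gamma phi0 (fun l => S l w) j i in
  let Psi j w := miso_psi f gamma phi0 alpha (fun l => S l w) j in
  let isE_k := is_cond_expectation P (sigma_state (x k) (phi k)) in
  (exists Z, isE_k (Psi k.+1) Z) /\
  (forall Z, isE_k (Psi k.+1) Z ->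
     {ae P, forall w,
        Z w <= Psi k w -
               gamma * tau / (4 * n%:R) * enorm (grad (avg f) (x k w)) ^+ 2}).
Proof.
move=> x phi Psi isE_k.
set p := tau / n%:R; set C := 6 * M / tau + 1.
have n_gt0R : 0 < n%:R :> R by rewrite ltr0n.
have n_neq0 : n%:R != 0 :> R by rewrite gt_eqF.
have mu_p i : inclusion_prob mu i = p.
  rewrite /p htau expected_sizeE.
  under eq_bigr do rewrite (huniform _ i).
  by rewrite sumr_const card_ord -[_ *+ n]mulr_natr mulfK.
have p_gt0 : 0 < p by rewrite -(mu_p (Ordinal hn)).
have p_le1 : p <= 1 by rewrite -(mu_p (Ordinal hn)) inclusion_prob_le1.
have tauE : tau = p * n%:R by rewrite /p divfK.
have tau_gt0 : 0 < tau by rewrite tauE mulr_gt0.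
have M_ge1 : 1 <= M.
  by rewrite hM (max_cond_expected_size_ge1 hmu (Ordinal hn)).
have M_ge0 : 0 <= M by lra.
have C_ge : 1 + 6 * max_cond_expected_size mu / n%:R <= C.
  rewrite -hM /C addrC lerD2r ler_wpM2l ?mulr_ge0// lef_pV2 ?posrE//.
  by rewrite tauE ler_piMl// ltW.
have C_ge0 : 0 <= C by rewrite /C addr_ge0// divr_ge0 ?mulr_ge0// ltW.
have q_ge4 : 4 <= q by rewrite hq le_max lexx.
have q_geBC : 2 * B * C <= q by rewrite hq le_max lexx orbT.
have q_ge0 : 0 <= q by lra.
have Lf_ge0 := smooth_ge0 hf.
have tauA_ge0 : 0 <= tau * A by rewrite mulr_ge0// ltW.
have nn_gt0 : 0 < n%:R ^+ 2 :> R by rewrite exprn_gt0.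
have ratio c : c * (tau * A) <= n%:R ^+ 2 -> c * (p * A / n%:R) <= 1.
  move=> c_le; rewrite -(ler_pM2r nn_gt0) mul1r; apply: le_trans c_le.
  by rewrite le_eqVlt; apply/predU1l; rewrite tauE; field.
move: hstep; rewrite !le_min hrho => /and4P[step1 step2 step3 step4].
have {}step1 : gamma * B * Lf * p <= 1 / 2.
  have BLf_ge0 : 0 <= 2 * B * Lf * tau by rewrite !mulr_ge0// ltW.
  have := lee_div_fin (ltW n_gt0R) BLf_ge0 step1.
  rewrite tauE => h; rewrite -(ler_pM2r n_gt0R); lra.
have {}step2 : 24 * q * Lf * gamma * (p * A / n%:R) <= 1.
  have qLf_ge0 : 0 <= 24 * q * Lf by rewrite !mulr_ge0.
  apply: ratio; rewrite [_ * gamma]mulrC.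
  exact: lee_div_div_fin nn_gt0 tauA_ge0 qLf_ge0 step2.
have {}step3 : 24 * q * Lf * L ^+ 2 * gamma ^+ 3 * (p * A / n%:R) <= 1.
  have qLfL_ge0 : 0 <= 24 * q * Lf * L ^+ 2
    by rewrite mulr_ge0 ?sqr_ge0// !mulr_ge0.
  apply: ratio; rewrite [_ * gamma ^+ 3]mulrC.
  exact: (@lee_root_div_fin _ 3 _ _ _ _ _ nn_gt0 tauA_ge0
    qLfL_ge0 (ltW hgamma) step3).
have {}step4 : 24 * C * L ^+ 2 * gamma ^+ 2 * (p * A / n%:R) <= 1.
  have CL_ge0 : 0 <= 24 * C * L ^+ 2 by rewrite mulr_ge0 ?sqr_ge0// !mulr_ge0.
  apply: ratio; rewrite [_ * gamma ^+ 2]mulrC.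
  exact: (@lee_root_div_fin _ 2 _ _ _ _ _ nn_gt0 tauA_ge0
    CL_ge0 (ltW hgamma) step4).
have cond : 24 * C * (p * A / n%:R) <= 1.
  apply: ratio; rewrite hrho in hcond.
  exact: lee_div_fin (ltW nn_gt0) tauA_ge0 hcond.
pose m (v : {ffun 'I_k -> {set 'I_n}}) := miso_phi f gamma phi0 (extend_history v) k.
have phiE w : (fun i => phi k i w) = m (draw_history S k w).
  apply: miso_phi_history => j jk.
  by rewrite -[j in RHS]/(nat_of_ord (Ordinal jk)) extend_historyE ffunE.
have xE : x k = fun w => miso_point f gamma (m (draw_history S k w)).
  by apply/funext => w; apply: (congr1 (miso_point f gamma) (phiE w)).
have phi_kE : phi k = fun i w => m (draw_history S k w) i.
  by apply/funext => i; apply/funext => w; apply: (congr1 (fun z => z i) (phiE w)).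
have GE : sigma_state (x k) (phi k) =
    [set (m \o draw_history S k) @^-1` V | V in setT].
  rewrite xE phi_kE.
  exact: (sigma_state_finite (draw_history S k) m (miso_point f gamma)).
pose Q z A' := miso_lyapunov f gamma alpha (miso_update f gamma z A').
have PsiE : Psi k.+1 = fun w => Q (m (draw_history S k w)) (S k w).
  by apply/funext => w; rewrite -phiE.
have is_version := averaged_draw_cond_expectation Q
  (draw_history_measurable hS (k := k)) (draw_measurable hS k)
  (draw_history_indep hS (k := k)) GE.
rewrite -PsiE in is_version.
split; first by eexists; exact: is_version.
move=> Z isZ.
have := cond_expectation_unique (draw_history_measurable hS (k := k)) GE
  isZ is_version.
apply: filterS => w ->.
have PsikE : Psi k w = miso_lyapunov f gamma alpha (m (draw_history S k w)).
  exact: (congr1 (miso_lyapunov f gamma alpha) (phiE w)).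
have -> : gamma * tau / (4 * n%:R) = gamma * p / 4 by rewrite /p; field.
rewrite PsikE xE.
exact: (miso_expected_decrease hn hf hfi hmu hproper mu_p hA hB hAB C_ge q_ge4
  q_geBC hgamma (etrans halpha (congr1 (fun b => b / q) hbeta)) step1 cond step2
  step3 step4 (m (draw_history S k w))).
Qed.
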